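(* Let $(\mathcal{U}, \tau_{\mathcal{R}}(\mathcal{X}))$ and $(\mathcal{V}, \tau_{\mathcal{R}'}(\mathcal{Y}))$ be nano topological spaces and let $\psi: \mathcal{U} \to \mathcal{V}$ be a function. Then the following are equivalent: (1) $\psi$ is nano $h$-continuous. (2) $\psi^{-1}(\mathcal{K})$ is nano $h$-closed in $\mathcal{U}$ for every nano closed set $\mathcal{K}$ in $\mathcal{V}$. (3) $\psi(nCl_h(\mathcal{B})) \subseteq nCl(\psi(\mathcal{B}))$ for each subset $\mathcal{B}$ of $\mathcal{U}$. (4) $nCl_h(\psi^{-1}(\mathcal{C})) \subseteq \psi^{-1}(nCl(\mathcal{C}))$ for each subset $\mathcal{C}$ of $\mathcal{V}$. (5) $\psi^{-1}(nInt(\mathcal{C})) \subseteq nInt_h(\psi^{-1}(\mathcal{C}))$ for each subset $\mathcal{C}$ of $\mathcal{V}$.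
   Context: Nano topological space: let $\mathcal{U}$ be a non-empty finite set (the universe), $\mathcal{R}$ an equivalence relation on $\mathcal{U}$ with $\mathcal{R}(x)$ the equivalence class of $x$, and $\mathcal{X} \subseteq \mathcal{U}$. Put $\mathcal{L}_{\mathcal{R}}(\mathcal{X}) = \bigcup_{x \in \mathcal{U}} \{\mathcal{R}(x) : \mathcal{R}(x) \subseteq \mathcal{X}\}$ (lower approximation), $\mathcal{U}_{\mathcal{R}}(\mathcal{X}) = \bigcup_{x \in \mathcal{U}} \{\mathcal{R}(x) : \mathcal{R}(x) \cap \mathcal{X} \neq \emptyset\}$ (upper approximation) and $\mathcal{B}_{\mathcal{R}}(\mathcal{X}) = \mathcal{U}_{\mathcal{R}}(\mathcal{X}) \setminus \mathcal{L}_{\mathcal{R}}(\mathcal{X})$ (boundary region). The nano topology on $\mathcal{U}$ with respect to $\mathcal{X}$ is $\tau_{\mathcal{R}}(\mathcal{X}) = \{\emptyset, \mathcal{U}, \mathcal{L}_{\mathcal{R}}(\mathcal{X}), \mathcal{U}_{\mathcal{R}}(\mathcal{X}), \mathcal{B}_{\mathcal{R}}(\mathcal{X})\}$, and $(\mathcal{U}, \tau_{\mathcal{R}}(\mathcal{X}))$ is called a nano topological space; likewise $(\mathcal{V}, \tau_{\mathcal{R}'}(\mathcal{Y}))$ for a non-empty finite set $\mathcal{V}$, an equivalence relation $\mathcal{R}'$ on $\mathcal{V}$ and $\mathcal{Y} \subseteq \mathcal{V}$. Members of the nano topology are called nano open sets; their complements are nano closed sets. For a subset $\mathcal{B}$,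 $nInt(\mathcal{B})$ is the union of all nano open sets contained in $\mathcal{B}$, and $nCl(\mathcal{B})$ is the intersection of all nano closed sets containing $\mathcal{B}$. A subset $\mathcal{B}$ of a nano topological space $\mathcal{U}$ is nano $h$-open if $\mathcal{B} \subseteq nInt(\mathcal{B} \cup \mathcal{O})$ for every nano open set $\mathcal{O}$ with $\mathcal{O} \neq \emptyset$ and $\mathcal{O} \neq \mathcal{U}$; the complement of a nano $h$-open set is called nano $h$-closed. The nano $h$-interior $nInt_h(\mathcal{B})$ is the union of all nano $h$-open sets contained in $\mathcal{B}$, and the nano $h$-closure $nCl_h(\mathcal{B})$ is the intersection of all nano $h$-closed sets containing $\mathcal{B}$. A map $\psi: \mathcal{U} \to \mathcal{V}$ between nano topological spaces is nano $h$-continuous if $\psi^{-1}(\mathcal{O})$ is nano $h$-open in $\mathcal{U}$ for every nano open set $\mathcal{O}$ in $\mathcal{V}$. *)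

(* Defs.v *)
From mathcomp Require Import all_boot.

Set Implicit Arguments.
Unset Strict Implicit.
Unset Printing Implicit Defensive.

Section NanoSpace.

Variables (U : finType) (R : rel U) (X : {set U}).
Implicit Types (x : U) (B O K : {set U}).

Definition eqclass x : {set U} := [set y | R x y].

Definition lower_approx : {set U} :=
  \bigcup_(x | eqclass x \subset X) eqclass x.

Definition upper_approx : {set U} :=
  \bigcup_(x | eqclass x :&: X != set0) eqclass x.

Definition boundary_region : {set U} := upper_approx :\: lower_approx.

Definition nano_topology : {set {set U}} :=
  [set set0; [set: U]; lower_approx; upper_approx; boundary_region].

Definition nano_open O : bool := O \in nano_topology.

Definition nano_closed K : bool := nano_open (~: K).

Definition nInt B : {set U} := \bigcup_(O | nano_open O && (O \subset B)) O.

Definition nCl B : {set U} := \bigcap_(K | nano_closed K && (B \subset K)) K.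

Definition nano_h_open B : bool :=
  [forall (O : {set U} | [&& nano_open O, O != set0 & O != [set: U]]),
     B \subset nInt (B :|: O)].

Definition nano_h_closed B : bool := nano_h_open (~: B).

Definition nInt_h B : {set U} :=
  \bigcup_(O | nano_h_open O && (O \subset B)) O.

Definition nCl_h B : {set U} :=
  \bigcap_(K | nano_h_closed K && (B \subset K)) K.

End NanoSpace.

Definition nano_h_continuous (U V : finType) (R : rel U) (X : {set U})
    (R' : rel V) (Y : {set V}) (psi : U -> V) : Prop :=
  forall O : {set V}, nano_open R' Y O -> nano_h_open R X (psi @^-1: O).

(* Main.v *)
Require Import Defs.
From mathcomp Require Import all_boot.

(** The equivalence is formal once two facts are known.  First, complementation
    exchanges closure and interior, for nano open sets as well as for nano
    h-open sets ([setC_nCl], [setC_nCl_h]); this links the closure conditions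
    to the interior condition.  Secondly, nano h-open sets are stable under
    unions, because [nInt] is monotone; hence [nInt_h B] is itself nano h-open
    ([nano_h_open_nInt_h]), which is what brings the last condition back to
    h-continuity: if the preimage of an open set lies in its own h-interior, it
    equals that h-interior.

    The remaining implications use only preimages: each closed [K] containing
    [psi @: B] pulls back to an h-closed set containing [B], hence containing
    the h-closure of [B]. *)

(** De Morgan's law between an interior and a closure operator, for an
    arbitrary family [P] of open sets: [O |-> ~: O] matches the members of [P]
    inside [B] with the [P]-closed sets around [~: B]. *)
Lemma setC_bigcap_closed (T : finType) (P : pred {set T}) (B : {set T}) :
  ~: (\bigcap_(K : {set T} | P (~: K) && (~: B \subset K)) K) =
  \bigcup_(O : {set T} | P O && (O \subset B)) O.
Proof.
rewrite setC_bigcap (reindex_inj (@setC_inj T)) /=.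
by apply: eq_big => [O | O _]; rewrite setCK // setCS.
Qed.

Section NanoSpaceTheory.

Variables (U : finType) (R : rel U) (X : {set U}).
Implicit Types B C O K : {set U}.

Lemma setC_nCl B : ~: nCl R X (~: B) = nInt R X B.
Proof. exact: setC_bigcap_closed. Qed.

Lemma setC_nCl_h B : ~: nCl_h R X (~: B) = nInt_h R X B.
Proof. exact: setC_bigcap_closed. Qed.

Lemma nIntS B C : B \subset C -> nInt R X B \subset nInt R X C.
Proof.
move=> sBC; apply/bigcupsP => O /andP[openO sOB].
by apply: bigcup_sup; rewrite openO (subset_trans sOB).
Qed.

Lemma nClS B C : B \subset C -> nCl R X B \subset nCl R X C.
Proof.
move=> sBC; apply/bigcapsP => K /andP[closedK sCK].
by apply: bigcap_inf; rewrite closedK (subset_trans sBC).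
Qed.

Lemma sub_nInt_open O : nano_open R X O -> O \subset nInt R X O.
Proof. by move=> openO; apply: bigcup_sup; rewrite openO subxx. Qed.

Lemma nInt_h_sub B : nInt_h R X B \subset B.
Proof. by apply/bigcupsP => O /andP[]. Qed.

Lemma nCl_h_min B K :
  nano_h_closed R X K -> B \subset K -> nCl_h R X B \subset K.
Proof. by move=> closedK sBK; apply: bigcap_inf; rewrite closedK. Qed.

(** Stability under unions: for each member [A i] and each test set [O],
    monotonicity of [nInt] enlarges [A i :|: O] to the union with [O]. *)
Lemma nano_h_open_bigcup (I : finType) (P : pred I) (A : I -> {set U}) :
    (forall i, P i -> nano_h_open R X (A i)) ->
  nano_h_open R X (\bigcup_(i | P i) A i).
Proof.
move=> openA; apply/forall_inP => O properO; apply/bigcupsP => i Pi.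
apply: subset_trans (forall_inP (openA i Pi) O properO) _.
exact/nIntS/setSU/bigcup_sup.
Qed.

Lemma nano_h_open_nInt_h B : nano_h_open R X (nInt_h R X B).
Proof. by apply: nano_h_open_bigcup => O /andP[]. Qed.

End NanoSpaceTheory.

Theorem theorem3p16
  (U : finType) (R : rel U) (X : {set U})
  (hU : 0 < #|U|) (hR : equivalence_rel R)
  (V : finType) (R' : rel V) (Y : {set V})
  (hV : 0 < #|V|) (hR' : equivalence_rel R')
  (psi : U -> V) :
  [<-> nano_h_continuous R X R' Y psi;
       forall K : {set V}, nano_closed R' Y K ->
         nano_h_closed R X (psi @^-1: K);
       forall B : {set U}, psi @: nCl_h R X B \subset nCl R' Y (psi @: B);
       forall C : {set V},
         nCl_h R X (psi @^-1: C) \subset psi @^-1: nCl R' Y C;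
       forall C : {set V},
         psi @^-1: nInt R' Y C \subset nInt_h R X (psi @^-1: C)].
Proof.
tfae.
- by move=> contpsi K closedK; rewrite /nano_h_closed -preimsetC; apply: contpsi.
- move=> closedpsi B; apply/bigcapsP => K /andP[closedK].
  rewrite !sub_imset_pre; exact/nCl_h_min/closedpsi.
- move=> clpsi C; rewrite -sub_imset_pre.
  apply: subset_trans (clpsi _) _; apply: nClS.
  by rewrite sub_imset_pre.
- move=> clpsi C.
  by rewrite -setC_nCl -setC_nCl_h preimsetC setCS -preimsetC.
- move=> intpsi O openO.
  suff -> : psi @^-1: O = nInt_h R X (psi @^-1: O) by apply: nano_h_open_nInt_h.
  apply/eqP; rewrite eqEsubset nInt_h_sub andbT.
  apply: subset_trans (intpsi O).
  exact/preimsetS/sub_nInt_open.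
Qed.
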